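(* Let $d\ge2$ and consider the Cayley tree of order $d$. There exists a critical activity $\lambda_b(d)\in(0,\infty)$, depending only on $d$, such that $p_s(\beta,\lambda,d)>0$ for all $\lambda\ge\lambda_b(d)$, uniformly for all $\beta>0$ and any $s\le d-1$. Here $p_s(\beta,\lambda,d)$ denotes the probability that a fixed occupied site, when the sites are occupied according to the time-evolved intermediate measure $\mu^{\#}_{\beta,\lambda,t}$, is the root of an outward growing occupied subtree in which each vertex has at least $s$ children.
   Context: The Cayley tree of order $d$ is the infinite tree $(V,E)$ in which each vertex has exactly $d+1$ neighbours. $\Omega=\{-1,0,1\}^V$ with the product $\sigma$-algebra; $\sigma_i$ is the $i$-th coordinate, $\mathcal F_\Lambda$ the $\sigma$-algebra generated by $(\sigma_i)_{i\in\Lambda}$; $\Lambda\Subset V$ means finite subset. A site $i$ is occupied if $|\sigma_i|=1$. Soft-core Widom-Rowlinson model (zero magnetic field), $\beta>0$ (repulsion), $\lambda>0$ (activity): for $\Lambda\Subset V$, $$\gamma_\Lambda(\sigma_\Lambda=\omega_\Lambda\mid\eta_{\Lambda^c})=\frac1{Z_\Lambda(\eta_{\Lambda^c})}\exp\Big(-\beta\sum_{\{i,j\}\in E,\{i,j\}\cap\Lambda\ne\emptyset}1_{\{\tilde\omega_i\tilde\omega_j=-1\}}\Big)\prod_{i\in\Lambda}\lambda^{\omega_i^2},\qquad \tilde\omega=\omega_\Lambda\eta_{\Lambda^c}.$$ Gibbs measures of the model are probability measures $\mu$ with $\mu=\mu\gamma_\Lambda$ for all $\Lambda\Subset V$. A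 probability measure $\mu$ on $\Omega$ is a tree-indexed Markov chain if for each oriented edge $ij$ one has $\mu(\sigma_j=x\mid\mathcal F_{(-\infty,ij)})=\mu(\sigma_j=x\mid\mathcal F_{\{i\}})$ $\mu$-a.s. for all $x$, where $(-\infty,ij)$ is the set of vertices $k$ whose self-avoiding path to $i$ does not contain $j$. The intermediate measure $\mu^{\#}_{\beta,\lambda}$ is the unique Gibbs measure of the model that is a tree-indexed Markov chain, invariant under all tree automorphisms, and invariant under the spin flip $\omega\mapsto-\omega$. Concretely, let $\xi=\xi_{\beta,\lambda}$ be the unique positive solution of $x=\lambda\big(\frac{1+(1+e^{-\beta})x}{1+2x}\big)^d$; then $\mu^{\#}_{\beta,\lambda}$ is the homogeneous tree-indexed Markov chain with transition matrix $P$ given, for signs $\epsilon\in\{-1,1\}$, by $P(\epsilon,\epsilon)=\frac{\xi}{1+(1+e^{-\beta})\xi}$, $P(\epsilon,-\epsilon)=\frac{e^{-\beta}\xi}{1+(1+e^{-\beta})\xi}$, $P(\epsilon,0)=\frac{1}{1+(1+e^{-\beta})\xi}$, and $P(0,\pm1)=\frac{\xi}{1+2\xi}$, $P(0,0)=\frac1{1+2\xi}$, with the $P$-invariant distribution as single-site marginal. Time evolution: $\mu^{\#}_{\beta,\lambda,t}$, $t\ge0$, is the image of $\mu^{\#}_{\beta,\lambda}$ under the product kernel acting independently at each site by $p_t(\omega,\eta)=\tfrac12(1+e^{-2t})1_{\{\omega=\eta\ne0\}}+\tfrac12(1-e^{-2t})1_{\{\omega\eta=-1\}}+1_{\{\omega=\eta=0\}}$.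 This does not change which sites are occupied, so the law of the set of occupied sites, and hence $p_s$, does not depend on $t$. Precise meaning of $p_s(\beta,\lambda,d)$: fix an origin $o\in V$ and a vertex $v\ne o$; the children of a vertex $w$ are its neighbours that are further away from $o$ (so $v$ and each of its descendants has $d$ children). Then $p_s(\beta,\lambda,d)$ is the conditional probability, given that $v$ is occupied, that there exists a set $T$ consisting of $v$ and descendants of $v$, with $v\in T$, such that all sites of $T$ are occupied and every vertex in $T$ has at least $s$ children belonging to $T$. This does not depend on the choice of $o,v$. *)

(* Defs.v *)
From HB Require Import structures.
From mathcomp Require Import all_boot all_order all_algebra finmap.
From mathcomp Require Import all_classical all_reals all_analysis.

Set Implicit Arguments.
Unset Strict Implicit.
Unset Printing Implicit Defensive.

Import Order.TTheory GRing.Theory Num.Theory.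
Import numFieldNormedType.Exports.

Local Open Scope classical_set_scope.
Local Open Scope ring_scope.

Inductive spin : Type := Minus | Zero | Plus.

Definition spin_val (x : spin) : int :=
  match x with Minus => -1 | Zero => 0 | Plus => 1 end.

Definition spin_flip (x : spin) : spin :=
  match x with Minus => Plus | Zero => Zero | Plus => Minus end.

Definition spin_code (x : spin) : option bool :=
  match x with Minus => Some false | Zero => None | Plus => Some true end.
Definition spin_decode (c : option bool) : spin :=
  match c with Some false => Minus | None => Zero | Some true => Plus end.
Lemma spin_codeK : cancel spin_code spin_decode.
Proof. by case. Qed.

HB.instance Definition _ := Finite.copy spin (can_type spin_codeK).
HB.instance Definition _ := isPointed.Build spin Zero.

Definition occupied (x : spin) : bool := `|spin_val x| == 1.

Definition clash (x y : spin) : bool := spin_val x * spin_val y == -1.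

Definition adj (V : choiceType) (nbr : V -> {fset V}) : rel V :=
  fun i j => j \in nbr i.

Record cayley_tree (d : nat) (V : choiceType) (nbr : V -> {fset V}) : Prop := {
  cayley_inhabited : inhabited V;
  cayley_sym : symmetric (adj nbr);
  cayley_irr : irreflexive (adj nbr);
  cayley_degree : forall i, #|` nbr i| = d.+1;
  cayley_connected : forall i j, exists2 p, path (adj nbr) i p & last i p = j;
  (* [ucycle] is also satisfied by back-and-forth walks [:: i; j] *)
  cayley_acyclic : forall c : seq V, ucycle (adj nbr) c -> (size c <= 2)%N }.

(* (-oo, ij) for an oriented edge ij; in a tree the self-avoiding path p from k
   to i is unique *)
Definition past (V : choiceType) (nbr : V -> {fset V}) (i j : V) : set V :=
  [set k | exists p, [/\ path (adj nbr) k p, last k p = i,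
                         uniq (k :: p) & j \notin k :: p]].

Definition walk (V : choiceType) (nbr : V -> {fset V}) (i j : V) (n : nat) :=
  exists p, [/\ path (adj nbr) i p, last i p = j & size p = n].

Definition dist (V : choiceType) (nbr : V -> {fset V}) (i j : V) : nat :=
  xget 0%N [set n | walk nbr i j n /\
                    forall m, walk nbr i j m -> (n <= m)%N].

Definition children (V : choiceType) (nbr : V -> {fset V}) (o w : V)
    : {fset V} :=
  [fset c in nbr w | (dist nbr o w < dist nbr o c)%N]%fset.

(* a vertex counts as its own descendant *)
Definition descendants (V : choiceType) (nbr : V -> {fset V}) (o v : V)
    : set V :=
  [set w | exists2 p, path (fun a b => b \in children nbr o a) v p
                      & last v p = w].

(* [cylinders L] generates F_L, the sigma-algebra of the coordinates in L *)
Definition cylinders (V : choiceType) (L : set V) : set (set (V -> spin)) :=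
  [set A | exists2 i, L i & exists x, A = [set omega | omega i = x]].

Definition sigma_on (V : choiceType) (L : set V) : set (set (V -> spin)) :=
  <<s cylinders L >>.

Definition config (V : choiceType) :=
  g_sigma_algebraType (@cylinders V [set: V]).

Definition glue (V : choiceType) (L : {fset V}) (omega : {ffun L -> spin})
    (eta : V -> spin) : V -> spin :=
  fun i => if insub i is Some k then omega k else eta i.

Section Specification.
Context {R : realType} {V : choiceType} (nbr : V -> {fset V}).
Context (beta lambda : R).

(* unoriented edges {i, j}, as two-element sets, that meet L *)
Definition edges_meeting (L : {fset V}) : {fset {fset V}} :=
  [fset [fset i; j] | i in L, j in nbr i]%fset.

Definition edge_clash (omega : V -> spin) (e : {fset V}) : bool :=
  [exists i : e, exists j : e, clash (omega (val i)) (omega (val j))].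

Definition boltzmann (L : {fset V}) (omega : V -> spin) : R :=
  expR (- beta * \sum_(e <- edges_meeting L) (edge_clash omega e)%:R)
  * \prod_(i <- L) lambda ^ (spin_val (omega i) ^+ 2).

Definition partition_function (L : {fset V}) (eta : V -> spin) : R :=
  \sum_(omega : {ffun L -> spin}) boltzmann L (glue omega eta).

Definition gamma (L : {fset V}) (eta : V -> spin) (A : set (V -> spin)) : R :=
  \sum_(omega : {ffun L -> spin})
     boltzmann L (glue omega eta) / partition_function L eta
     * \1_A (glue omega eta).

Definition gibbs_measure (mu : probability (config V) R) : Prop :=
  forall (L : {fset V}) (A : set (config V)), measurable A ->
    mu A = (\int[mu]_eta (gamma L eta A)%:E)%E.

End Specification.

(* f is a version of mu(A | F) *)
Definition cond_prob_version {R : realType} {V : choiceType}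
    (mu : probability (config V) R) (F : set (set (config V)))
    (A : set (config V)) (f : config V -> R) : Prop :=
  [/\ (forall B : set R, measurable B -> F (f @^-1` B)),
      mu.-integrable setT (EFin \o f) &
      forall B, F B -> (\int[mu]_(omega in B) (f omega)%:E)%E = mu (A `&` B)].

Definition tree_markov_chain {R : realType} {V : choiceType}
    (nbr : V -> {fset V}) (mu : probability (config V) R) : Prop :=
  forall i j, adj nbr i j -> forall x : spin,
  exists f g : config V -> R,
    [/\ cond_prob_version mu (sigma_on (past nbr i j))
          [set omega | omega j = x] f,
        cond_prob_version mu (sigma_on [set i]) [set omega | omega j = x] g &
        {ae mu, forall omega, f omega = g omega}].

Definition automorphism (V : choiceType) (nbr : V -> {fset V}) (phi : V -> V) :=
  bijective phi /\ forall i j, adj nbr (phi i) (phi j) = adj nbr i j.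

Definition automorphism_invariant {R : realType} {V : choiceType}
    (nbr : V -> {fset V}) (mu : probability (config V) R) : Prop :=
  forall phi, automorphism nbr phi ->
  forall A : set (config V), measurable A ->
    mu [set omega : config V | A (fun i => omega (phi i))] = mu A.

Definition flip_invariant {R : realType} {V : choiceType}
    (mu : probability (config V) R) : Prop :=
  forall A : set (config V), measurable A ->
    mu [set omega : config V | A (fun i => spin_flip (omega i))] = mu A.

(* For beta, lambda > 0 exactly one probability measure has these properties. *)
Record intermediate_measure {R : realType} {V : choiceType}
    (nbr : V -> {fset V}) (beta lambda : R)
    (mu : probability (config V) R) : Prop := {
  intermediate_gibbs : gibbs_measure nbr beta lambda mu;
  intermediate_markov : tree_markov_chain nbr mu;
  intermediate_automorphism : automorphism_invariant nbr mu;
  intermediate_flip : flip_invariant mu }.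

Definition flip_kernel {R : realType} (t : R) (x y : spin) : R :=
  2^-1 * (1 + expR (- 2 * t)) * ((x == y) && (y != Zero))%:R
  + 2^-1 * (1 - expR (- 2 * t)) * (clash x y)%:R
  + ((x == Zero) && (y == Zero))%:R.

(* Its values on finite-dimensional cylinders determine the product kernel. *)
Definition product_flip_kernel {R : realType} {V : choiceType} (t : R)
    (K : R.-pker (config V) ~> (config V)) : Prop :=
  forall (omega eta : V -> spin) (L : {fset V}),
    K omega [set zeta | forall i, i \in L -> zeta i = eta i]
    = (\prod_(i <- L) flip_kernel t (omega i) (eta i))%:E.

Definition time_evolved {R : realType} {V : choiceType} (t : R)
    (mu mut : probability (config V) R) : Prop :=
  exists2 K : R.-pker (config V) ~> (config V), product_flip_kernel t K &
  forall A : set (config V), measurable A ->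
    mut A = (\int[mu]_omega K omega A)%E.

Definition has_occupied_subtree (V : choiceType) (nbr : V -> {fset V})
    (o v : V) (s : nat) (omega : V -> spin) : Prop :=
  exists T : set V,
    [/\ T `<=` descendants nbr o v, T v,
        (forall w, T w -> occupied (omega w)) &
        forall w, T w -> (s <= #|` [fset c in children nbr o w | c \in T]%fset|)%N].

(* p_s; as x / 0 = 0, it vanishes if v is almost surely not occupied *)
Definition subtree_prob {R : realType} {V : choiceType} (nbr : V -> {fset V})
    (mut : probability (config V) R) (o v : V) (s : nat) : R :=
  fine (mut ([set omega | has_occupied_subtree nbr o v s omega]
             `&` [set omega | occupied (omega v)]))
  / fine (mut [set omega | occupied (omega v)]).

(* Main.v *)
Require Import Defs.
From mathcomp Require Import all_boot all_order all_algebra finmap.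
From mathcomp Require Import all_classical all_reals all_analysis.
From mathcomp Require Import zify ring lra.

Import Order.TTheory GRing.Theory Num.Theory.

Local Open Scope ring_scope.

(** The estimate that drives the proof is that, for every oriented edge [ij] and
   every event [A] of the past of [ij],
     [(1 + lambda) / 2^d * mu (A, sigma_j = 0) <= mu A],
   which is uniform in [beta].  Let [A] force [sigma_i] to differ from a sign
   [z].  Conditionally on [sigma_j = 0] and on everything before the edge [jk],
   each of the [d] further neighbours [k] of [j] takes the two signs with equal
   probability, by the Markov property and flip invariance; hence with
   conditional probability at least [2^-d] none of them equals [z].  Then no
   neighbour of [j] equals [z], so setting [sigma_j := -z] creates no clash and
   the single-site Gibbs weights of [0] and [-z] are [1] and [lambda].

   Let [delta = 1/(2d^2)].  If [lambda] is large, the estimate gives vacancy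
   probability at most [delta - (d delta)^2] at each new vertex.  By induction
   on [n], the conditional probability given the past that a vertex is not the
   root of an occupied [s]-ary tree of depth [n] is at most [delta]: otherwise
   the vertex is vacant or two of its [d] children fail.  Let [n] tend to
   infinity; compactness turns trees of all finite depths into an infinite one.
   The time evolution fixes every event determined by the occupied sites. *)

(** * Branches and distances in the Cayley tree *)

Section Tree.
Local Open Scope nat_scope.
Set Implicit Arguments.
Unset Strict Implicit.
Context {d : nat} {V : choiceType} {nbr : V -> {fset V}}.
Hypothesis T : cayley_tree d nbr.

(** The tree with [j] deleted. Excluding [j] at both ends makes the relation symmetric, so that
    walks can be reversed. *)
Let avoids (j : V) : rel V := fun x y => [&& adj nbr x y, x != j & y != j].

Lemma avoids_path (j k : V) p : k != j ->
  path (avoids j) k p = path (adj nbr) k p && (j \notin p).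
Proof.
elim: p k => //= a p IH k kj; rewrite {1}/avoids kj /= inE negb_or.
have [<-|aj] := eqVneq j a; first by rewrite !andbF.
by rewrite /= andbT IH 1?eq_sym ?andbA.
Qed.

Lemma avoids_sym j : symmetric (avoids j).
Proof.
by move=> x y; rewrite /avoids (cayley_sym T) [(x != j) && _]andbC.
Qed.

Lemma avoids_rev j x p : path (avoids j) x p ->
  exists2 q, path (avoids j) (last x p) q & last (last x p) q = x.
Proof.
move=> xp; exists (rev (belast x p)).
  by rewrite rev_path; apply: sub_path xp => a b; rewrite avoids_sym.
by case: p {xp} => //= a p; rewrite rev_cons last_rcons.
Qed.

(** A walk that avoids [j] shortens to a self-avoiding one, so self-avoidance may be dropped and
    walks may be concatenated freely. *)
Lemma pastP (i j k : V) : past nbr i j k <->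
  k != j /\ exists2 p, path (avoids j) k p & last k p = i.
Proof.
split=> [[p [kp pi _]]|[kj [p kp pi]]].
  rewrite inE negb_or eq_sym => /andP[kj jp]; split=> //.
  by exists p => //; rewrite avoids_path ?kp.
rewrite avoids_path // in kp; case/andP: kp => kp jp.
case/shortenP: kp pi => q kq uq sub qi.
exists q; split => //.
by rewrite inE negb_or eq_sym kj /=; apply: contra jp; apply: sub.
Qed.

(** Otherwise the walk, made self-avoiding and closed up through [w], would be a cycle with at least
    three vertices. *)
Lemma no_avoiding_path (w u k : V) p : adj nbr k w -> adj nbr u w ->
  path (avoids w) u p -> last u p = k -> u = k.
Proof.
move=> kw uw up lk; have uNw : u != w.
  by apply: contraTneq uw => ->; rewrite (cayley_irr T).
rewrite avoids_path// in up; case/andP: up => up wp.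
case/shortenP: up lk => q uq uniq_q sub lk.
have wq : w \notin q by apply: contra wp; apply: sub.
have : ucycle (adj nbr) [:: w, u & q].
  rewrite /ucycle /= rcons_path uq lk kw (cayley_sym T) uw inE negb_or.
  by rewrite eq_sym uNw wq; move: uniq_q => /= ->.
move=> /(cayley_acyclic T) /=; case: q {uq uniq_q sub wq} lk => //=.
Qed.

(** A vertex common to both branches at [w] would join [a] to [b] by a walk avoiding [w]. *)
Lemma past_nbr_disjoint (a b w x : V) : adj nbr a w -> adj nbr b w ->
  past nbr a w x -> past nbr b w x -> a = b.
Proof.
move=> aw bw /pastP[xw [p xp pa]] /pastP[_ [q xq qb]].
have [r ar rx] := avoids_rev xp; rewrite pa in ar rx.
apply: (@no_avoiding_path w a b (r ++ q)) => //.
  by rewrite cat_path ar rx.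
by rewrite last_cat rx.
Qed.

(** The walk from [x] to [k] is prolonged by [w]. If it visited [u], its remainder would join the
    neighbours [u] and [k] of [w] while avoiding [w]. This inclusion lets conditioning events
    accumulate from edge to edge. *)
Lemma past_step (k w u x : V) : adj nbr k w -> adj nbr w u -> k != u ->
  past nbr k w x -> past nbr w u x.
Proof.
move=> kw wu ku xk; have [xw [p xp pk]] := (pastP _ _ _).1 xk.
have wNu : w != u by apply: contraTneq wu => ->; rewrite (cayley_irr T).
have up : u \notin x :: p.
  apply/negP => xup; case/eqP: ku.
  have upk : exists2 r, path (avoids w) u r & last u r = k.
    move: xup; rewrite inE => /orP[/eqP ->|]; first by exists p.
    move=> up; case/splitPr: p / up xp pk => p1 p2.
    by rewrite cat_path last_cat /= => /and3P[_ _ up2] <-; exists p2.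
  case: upk => r ur rk.
  by apply/esym/(no_avoiding_path kw _ ur rk); rewrite (cayley_sym T).
rewrite inE negb_or in up; case/andP: up => ux up.
apply/pastP; split; first by rewrite eq_sym.
exists (rcons p w); last by rewrite last_rcons.
rewrite avoids_path; last by rewrite eq_sym.
rewrite avoids_path // in xp; case/andP: xp => xp _.
by rewrite rcons_path xp pk kw mem_rcons inE negb_or up eq_sym wNu.
Qed.

Lemma past_refl (i j : V) : adj nbr i j -> past nbr i j i.
Proof.
move=> ij; apply/pastP; split; last by exists [::].
by apply: contraTneq ij => ->; rewrite (cayley_irr T).
Qed.

Lemma past_notin (i j : V) : ~ past nbr i j j.
Proof. by move=> /pastP[]; rewrite eqxx. Qed.

Lemma dist_walk (o i : V) : walk nbr o i (dist nbr o i) /\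
  forall m, walk nbr o i m -> dist nbr o i <= m.
Proof.
have [p op pi] := cayley_connected T o i.
apply: (@xgetPex nat 0 [set n | walk nbr o i n /\
  forall m, walk nbr o i m -> n <= m]%classic).
have ex : exists n, `[< walk nbr o i n >].
  by exists (size p); apply/asboolP; exists p.
case: (ex_minnP ex) => n /asboolP wn min.
by exists n; split => // m wm; apply: min; apply/asboolP.
Qed.

(** A shortest path to [a] that met [w] would reach [w] strictly earlier, against the assumed order
    of the distances. *)
Lemma dist_le_past (o a w : V) : adj nbr a w -> w != o ->
  dist nbr o a <= dist nbr o w -> past nbr a w o.
Proof.
move=> aw wo le_aw; apply/pastP; rewrite eq_sym; split => //.
have [[p [op pa sp]] _] := dist_walk o a.
exists p => //; rewrite avoids_path; last by rewrite eq_sym.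
rewrite op /=; apply/negP => wp.
have aNw : a != w by apply: contraTneq aw => ->; rewrite (cayley_irr T).
case/splitPr: p / wp op pa sp => p1 p2 op pa sp.
have : dist nbr o w <= size (rcons p1 w).
  apply: (dist_walk o w).2; exists (rcons p1 w); rewrite last_rcons; split=> //.
  by move: op; rewrite -cat_rcons cat_path => /andP[].
move: pa sp; rewrite last_cat size_cat size_rcons /=.
case: p2 {op} => [/eqP|b p2] /=; first by rewrite eq_sym (negbTE aNw).
by move: le_aw; lia.
Qed.

Lemma dist_parent (o w : V) : w != o ->
  exists2 a, adj nbr a w & dist nbr o a < dist nbr o w.
Proof.
move=> wo; have [[p [op pw sp]] _] := dist_walk o w.
case/lastP: p op pw sp => [_ /= /eqP|p b]; first by rewrite eq_sym (negbTE wo).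
rewrite rcons_path last_rcons size_rcons => /andP[op lb] bw <-.
exists (last o p); first by rewrite -bw.
by rewrite ltnS; apply: (dist_walk o _).2; exists p.
Qed.

Lemma in_children (o w c : V) :
  (c \in children nbr o w) = adj nbr w c && (dist nbr o w < dist nbr o c).
Proof. by rewrite /children !inE. Qed.

Lemma parent_exists (o w : V) : w <> o -> exists u, w \in children nbr o u.
Proof.
move=> /eqP/dist_parent[a aw lt]; exists a.
by rewrite in_children aw.
Qed.

(** A neighbour of [w] that is not farther from [o] than [w] has [o] in its branch. So has [u], and
    branches at [w] are disjoint. *)
Lemma children_eq (o u w : V) : w \in children nbr o u ->
  children nbr o w = (nbr w `\ u)%fset.
Proof.
rewrite in_children => /andP[uw lt]; apply/fsetP => c.
have wo : w != o.
  apply: contraTneq lt => ->; rewrite -leqNgt.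
  by apply: leq_trans ((dist_walk o o).2 0 _) _ => //; exists [::].
rewrite in_children !inE; apply/andP/andP => [[wc ltc]|[cu wc]].
  by split=> //; apply: contraTneq ltc => ->; rewrite -leqNgt ltnW.
split=> //; rewrite ltnNge; apply: contra cu => le.
have cw : adj nbr c w by rewrite (cayley_sym T).
apply/eqP; apply: (@past_nbr_disjoint c u w o) => //.
  exact: dist_le_past.
exact/dist_le_past/ltnW.
Qed.

Lemma size_children (o u w : V) : w \in children nbr o u ->
  #|` children nbr o w| = d.
Proof.
move=> wu; rewrite (children_eq wu).
have uw : u \in nbr w.
  by move: wu; rewrite in_children => /andP[+ _]; rewrite (cayley_sym T).
by have := cayley_degree T w; rewrite (cardfsD1 u) uw => -[].
Qed.

End Tree.

(** * Sigma-algebras generated by sets of coordinates *)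

Section SigmaAlgebra.
Local Open Scope classical_set_scope.
Set Implicit Arguments.
Unset Strict Implicit.

Section Closure.
Context {X : Type} {F : set (set X)}.
Hypothesis sF : sigma_algebra setT F.

Lemma sigma_alg0 : F set0. Proof. by case: sF. Qed.

Lemma sigma_algC A : F A -> F (~` A).
Proof. by case: sF => _ FD _ FA; rewrite -setTD; apply: FD. Qed.

Lemma sigma_algU A B : F A -> F B -> F (A `|` B).
Proof.
case: sF => F0 _ FU FA FB; rewrite -bigcup2E.
by apply: FU => -[|[|n]].
Qed.

Lemma sigma_algI A B : F A -> F B -> F (A `&` B).
Proof.
move=> FA FB; rewrite -[A `&` B]setCK setCI.
by apply: sigma_algC; apply: sigma_algU; apply: sigma_algC.
Qed.

Lemma sigma_algT : F setT.
Proof. by rewrite -setC0; apply/sigma_algC/sigma_alg0. Qed.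

(** Any sigma-algebra is allowed because such counts occur both in pasts of edges and among the
    events fixed by the time evolution. *)
Lemma sigma_alg_count (I : eqType) (P : I -> pred X) (l : seq I) s :
  (forall i, i \in l -> F [set x | P i x]) ->
  F [set x | (s <= count (fun i => P i x) l)%N].
Proof.
elim: l s => [|i l IH] s FP /=.
  by case: s => [|s]; [rewrite (_ : mkset _ = setT)|rewrite (_ : mkset _ = set0)];
     rewrite ?predeqE//; [apply: sigma_algT|apply: sigma_alg0].
(* Either the head counts and the tail needs one fewer, or the tail suffices. For [s = 0] the
   predecessor is 0 again, and the second set is everything. *)
rewrite (_ : mkset _ = [set x | P i x] `&` [set x | (s.-1 <= count (P^~ x) l)%N]
    `|` [set x | (s <= count (P^~ x) l)%N]).
  have FPl j : j \in l -> F [set x | P j x].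
    by move=> jl; apply: FP; rewrite inE jl orbT.
  apply: sigma_algU; last exact: IH.
  by apply: sigma_algI; [apply: FP; rewrite mem_head|exact: IH].
rewrite predeqE => x /=; case: (P i x) => /=; split.
- by case: s => [|s] h; [right|left].
- by case => [[_]|]; lia.
- by right.
- by case => // -[].
Qed.

End Closure.

Context {V : choiceType}.
Implicit Types (L : set V) (A : set (V -> spin)).

Lemma sigma_on_sigma L : sigma_algebra setT (sigma_on L).
Proof. exact: smallest_sigma_algebra. Qed.

Lemma sigma_on_coord L i x : L i -> sigma_on L [set omega | omega i = x].
Proof. by move=> Li; apply: sub_sigma_algebra; exists i => //; exists x. Qed.

Lemma sigma_on_le L L' : L `<=` L' -> sigma_on L `<=` sigma_on L'.
Proof.
move=> LL' A LA; apply: (smallest_sub (sigma_on_sigma L') _ LA).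
by move=> _ [i Li [x ->]]; apply: sigma_on_coord; exact: LL'.
Qed.

Lemma sigma_on_measurable L A : sigma_on L A -> measurable (A : set (config V)).
Proof. exact: sigma_on_le. Qed.

(** The events that do not separate [omega] from [eta] form a sigma-algebra containing the cylinders
    over [L]. *)
Lemma sigma_on_determined L A (omega eta : V -> spin) : sigma_on L A ->
  (forall i, L i -> omega i = eta i) -> A omega -> A eta.
Proof.
move=> LA eqL; suff : A omega <-> A eta by case.
pose D : set (set (V -> spin)) := [set A | A omega <-> A eta].
apply: (@smallest_sub _ (sigma_algebra setT) (cylinders L) D _ _ A LA) => //.
  split => // [B|B DB]; rewrite /D /=; first by move=> h; split => -[_ nB]; split=> // /h.
  by split=> -[n _ /DB Bn]; exists n.
by move=> _ [i Li [x ->]]; rewrite /D /= eqL.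
Qed.

Lemma occupiedE (x : spin) : occupied x = (x != Zero).
Proof. by case: x. Qed.

Lemma sigma_on_occupied L i : L i -> sigma_on L [set omega | occupied (omega i)].
Proof.
move=> Li; rewrite (_ : mkset _ = ~` [set omega | omega i = Zero]).
  by apply: (sigma_algC (sigma_on_sigma L)); apply: sigma_on_coord.
by rewrite predeqE => w /=; rewrite occupiedE; split=> [/eqP|/eqP].
Qed.

End SigmaAlgebra.

(** * Integrals and real-valued probabilities *)

Section RealMeasure.
Local Open Scope classical_set_scope.
Set Implicit Arguments.
Unset Strict Implicit.
Context {R : realType} {dd : measure_display} {X : measurableType dd}.

(** The integral of a nonnegative function is a supremum over the simple functions below it. This
    form serves for [gamma], whose measurability in the boundary condition is left aside. *)
Lemma le_integral_nneg (mu : {measure set X -> \bar R}) (f g : X -> \bar R) :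
  (forall x, 0 <= f x)%E -> (forall x, f x <= g x)%E ->
  (\int[mu]_x f x <= \int[mu]_x g x)%E.
Proof.
move=> f0 fg; rewrite !ge0_integralE => [|x _|x _] //; last first.
  exact: le_trans (fg x).
rewrite !patch_setT; apply: le_ereal_sup => _ [h hf <-]; exists h => // x.
exact: le_trans (hf x) (fg x).
Qed.

Context (mu : probability X R).
Implicit Types A B C : set X.

Definition prob_real A : R := fine (mu A).

Lemma prob_realE A : measurable A -> mu A = (prob_real A)%:E.
Proof. by move=> mA; rewrite /prob_real fineK// fin_num_measure. Qed.

Lemma prob_real_ge0 A : 0 <= prob_real A.
Proof. exact/fine_ge0/measure_ge0. Qed.

Lemma prob_real_le A B : measurable A -> measurable B -> A `<=` B ->
  prob_real A <= prob_real B.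
Proof.
move=> mA mB AB; rewrite -lee_fin -!prob_realE//.
by apply: le_measure => //; rewrite inE.
Qed.

Lemma prob_realT : prob_real setT = 1.
Proof. by rewrite /prob_real probability_setT. Qed.

Lemma prob_real_split A B : measurable A -> measurable B ->
  prob_real A = prob_real (A `&` B) + prob_real (A `&` ~` B).
Proof.
move=> mA mB; have mAB := measurableI _ _ mA mB.
have mAC := measurableI _ _ mA (measurableC mB).
apply: EFin_inj; rewrite EFinD -!prob_realE // -measureU //.
  by rewrite -setIUr setUv setIT.
by rewrite setIACA setICr setI0.
Qed.

Lemma prob_real_leU A B C : measurable A -> measurable B -> measurable C ->
  A `<=` B `|` C -> prob_real A <= prob_real B + prob_real C.
Proof.
move=> mA mB mC sub; rewrite (prob_real_split mA mB).
have mI := measurableI _ _ mA (measurableC mB).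
apply: lerD; apply: prob_real_le => //; first exact: measurableI.
by move=> x [/sub[]].
Qed.

Lemma prob_real_union_bound (I : eqType) (S : I -> set X) (l : seq I) (c : R) A :
  measurable A -> (forall i, i \in l -> measurable (S i)) ->
  (forall i, i \in l -> prob_real (S i) <= c) ->
  (forall x, A x -> exists2 i, i \in l & S i x) ->
  prob_real A <= (size l)%:R * c.
Proof.
elim: l A => [|i l IH] A mA mS Sc sub.
  rewrite (_ : A = set0); last by rewrite -subset0 => x /sub[].
  by rewrite mul0r /prob_real measure0.
have mSi : measurable (S i) by apply: mS; rewrite mem_head.
rewrite (prob_real_split mA mSi) /= -natr1 mulrDl mul1r addrC.
apply: lerD.
  apply: IH => [|j jl|j jl|x [/sub[j]]]; first exact/measurableI/measurableC.
  - by apply: mS; rewrite inE jl orbT.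
  - by apply: Sc; rewrite inE jl orbT.
  - by rewrite inE => /orP[/eqP->//|jl]; exists j.
apply: le_trans (Sc i _); last by rewrite mem_head.
by apply: prob_real_le => //; exact: measurableI.
Qed.

End RealMeasure.

(** * Conditional probabilities across one edge and at one site *)

Section OneSite.
Local Open Scope classical_set_scope.
Set Implicit Arguments.
Unset Strict Implicit.
Context {R : realType} {V : choiceType} {nbr : V -> {fset V}}.
Context {mu : probability (config V) R}.
Let m := prob_real mu.

(** By the Markov property the conditional probability given the past depends on the spin at [j]
    only, hence is constant where that spin is [y]. The constant is the transition probability from
    [y] to [x] whenever [y] has positive mass at [j]. *)
Lemma markov_proportional (j k : V) (x y : spin) :
  tree_markov_chain nbr mu -> adj nbr j k ->
  exists c : R, forall B : set (config V), sigma_on (past nbr j k) B ->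
    B `<=` [set omega | omega j = y] ->
    m (B `&` [set omega | omega k = x]) = c * m B.
Proof.
move=> mc jk; have [f [g [[mf fi fE] [mg gi _] fg]]] := mc _ _ jk x.
(* Since [g] depends on the coordinate [j] only, the constant configuration represents all those
   with spin [y] at [j]. *)
pose c := g (fun=> y); exists c => B sB Bj.
have mB := sigma_on_measurable sB.
have gc omega : omega j = y -> g omega = c.
  move=> oj; apply: (sigma_on_determined (L := [set j]) (A := g @^-1` [set c])
    (omega := fun=> y)) => //; first by apply: mg; exact: measurable_set1.
  by move=> i ->.
have mx : measurable ([set omega | omega k = x] : set (config V)).
  exact: sigma_on_measurable (sigma_on_coord (L := setT) _ _).
have mI := measurableI _ _ mB mx.
apply: EFin_inj; rewrite EFinM -!prob_realE // setIC -(fE _ sB).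
rewrite -(integral_cst mu mB).
rewrite (ae_eq_integral (fun w => (g w)%:E)) //.
- by apply: eq_integral => w; rewrite inE => /Bj /gc ->.
- exact: measurable_funS measurableT (@subsetT _ _) (measurable_int _ fi).
- exact: measurable_funS measurableT (@subsetT _ _) (measurable_int _ gi).
- by apply: filterS fg => w /= -> _.
Qed.

(* The flip exchanges the two signs at [k] and fixes the event that [j] is
   vacant. *)
Lemma half_avoids_sign (j k : V) (y : spin) (B : set (config V)) :
  tree_markov_chain nbr mu -> flip_invariant mu -> adj nbr j k -> y != Zero ->
  sigma_on (past nbr j k) B -> B `<=` [set omega | omega j = Zero] ->
  past nbr j k j ->
  2^-1 * m B <= m (B `&` ~` [set omega | omega k = y]).
Proof.
move=> mc fi jk y0 sB BZ jj.
have [c1 c1E] := markov_proportional y Zero mc jk.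
have [c2 c2E] := markov_proportional (spin_flip y) Zero mc jk.
pose Z : set (config V) := [set omega | omega j = Zero].
have sZ : sigma_on (past nbr j k) Z by exact: sigma_on_coord.
have mB := sigma_on_measurable sB; have mZ := sigma_on_measurable sZ.
have mk x : measurable ([set omega | omega k = x] : set (config V)).
  exact: sigma_on_measurable (sigma_on_coord (L := setT) _ _).
have c12 : c1 * m Z = c2 * m Z.
  rewrite -c1E // -c2E // /m /prob_real.
  rewrite -(fi (Z `&` [set omega | omega k = y])); last exact: measurableI.
  congr (fine (mu _)); rewrite predeqE => w /=; rewrite /Z /=.
  by case: (w j); case: (w k); case: (y) y0 => //=; split=> -[].
have mBle : m B <= m Z by exact: prob_real_le.
have mB0 : 0 <= m B by exact: prob_real_ge0.
have spl := prob_real_split mu mB (mk y).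
rewrite -/m c1E // in spl.
have le2 : c2 * m B <= m (B `&` ~` [set omega | omega k = y]).
  rewrite -c2E //; apply: prob_real_le; [exact: measurableI| |].
    exact/measurableI/measurableC.
  by move=> w [Bw /= ->]; split=> //; case: (y) y0.
(* [c12] gives [c1 = c2] only if [Z] has positive mass; otherwise [B], a part of [Z], is null. *)
have [mZ0|mZ0] := eqVneq (m Z) 0.
  have -> : m B = 0 by apply/le_anti; rewrite mB0 -mZ0 mBle.
  by rewrite mulr0; apply: prob_real_ge0.
move/(mulIf mZ0): c12 => c12; rewrite -c12 in le2.
(* The mass of [B] is [c1 * m B] plus a remainder that is itself at least [c1 * m B]. *)
rewrite spl; lra.
Qed.

Lemma clash_sign (p q z : spin) : z != Zero -> p != z -> q != z ->
  clash p q = false.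
Proof. by case: p; case: q; case: z. Qed.

Let const_at (j : V) (x : spin) : {ffun [fset j]%fset -> spin} := [ffun=> x].

Lemma glue_const j x (eta : V -> spin) i :
  Defs.glue (const_at j x) eta i = if i == j then x else eta i.
Proof.
rewrite /Defs.glue; case: insubP => [u + _|]; rewrite inE; last by move/negbTE->.
by move=> ->; rewrite ffunE.
Qed.

Lemma ffun_fset1 j (w : {ffun [fset j]%fset -> spin}) :
  w = const_at j (w (Sub j (fset11 j))).
Proof.
apply/ffunP => i; rewrite ffunE; congr (w _); apply: val_inj => /=.
by have := valP i; rewrite inE => /eqP.
Qed.

Context {beta lambda : R}.
Hypothesis lambda0 : 0 < lambda.

Lemma boltzmann_gt0 (L : {fset V}) (w : V -> spin) :
  0 < boltzmann nbr beta lambda L w.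
Proof.
rewrite /boltzmann mulr_gt0 ?expR_gt0// prodr_gt0// => i _.
exact: exprz_gt0.
Qed.

(** Every edge meeting [{j}] has both ends different from [z], so none clashes and the factor with
    [beta] is 1. This is where uniformity in [beta] comes from. *)
Lemma boltzmann_no_clash (j : V) (x z : spin) (eta : V -> spin) :
  z != Zero -> x != z -> (forall n, n \in nbr j -> eta n != z) ->
  boltzmann nbr beta lambda [fset j]%fset (Defs.glue (const_at j x) eta)
  = lambda ^ (spin_val x ^+ 2).
Proof.
move=> z0 xz etaz; rewrite /boltzmann big_seq_fset1 glue_const eqxx.
rewrite big1_seq ?mulr0 ?expR0 ?mul1r // => e /=.
move=> /imfset2P[i /=]; rewrite inE => /eqP-> [n /= nj ->].
suff ok v : v \in [fset j; n]%fset -> Defs.glue (const_at j x) eta v != z.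
  rewrite /edge_clash; case: existsP => //= -[a /existsP[b]].
  by rewrite (@clash_sign _ _ z) // ok ?(valP a) ?(valP b).
rewrite glue_const; case: (eqVneq v j) => // vj.
by rewrite !inE (negbTE vj) /= => /eqP ->; apply: etaz.
Qed.

(** Off [C] both sides vanish, as [C] ignores the spin at [j]. On [C] the spins [0] and [-z] have
    weights 1 and [lambda], so the partition function is at least [1 + lambda]. *)
Lemma gamma_vacant_le (j : V) (z : spin) (C : set (V -> spin)) (eta : V -> spin) :
  z != Zero ->
  (forall omega eta, (forall i, i != j -> omega i = eta i) ->
    C omega -> C eta) ->
  (forall omega n, C omega -> n \in nbr j -> omega n != z) ->
  gamma nbr beta lambda [fset j]%fset eta
    (C `&` [set omega | omega j = Zero])
  <= (1 + lambda)^-1 * \1_C eta.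
Proof.
move=> z0 indC Cz; rewrite /gamma.
have [Ceta|nC] := pselect (C eta); last first.
  rewrite big1 => [|w _].
    by rewrite indicE memNset // mulr0.
  rewrite indicE memNset ?mulr0 // => -[Cw _]; apply: nC; apply: indC Cw => i ij.
  by rewrite (ffun_fset1 w) glue_const (negbTE ij).
rewrite (bigD1 (const_at j Zero)) //= big1 ?addr0 => [|w wZ]; last first.
  rewrite indicE memNset ?mulr0 // => -[_ /=].
  rewrite (ffun_fset1 w) glue_const eqxx => wj.
  by case/eqP: wZ; rewrite (ffun_fset1 w) wj.
have ez n : n \in nbr j -> eta n != z by apply: Cz.
rewrite (boltzmann_no_clash z0 _ ez); last by case: (z) z0.
rewrite !indicE !mem_set //; last first.
  split=> /=; last by rewrite glue_const eqxx.
  by apply: indC Ceta => i ij; rewrite glue_const (negbTE ij).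
rewrite !mulr1 expr0n /= expr0z div1r.
rewrite lef_pV2 ?posrE ?addr_gt0 //; last first.
  by rewrite /partition_function (bigD1 (const_at j Zero)) //= ltr_wpDr
    ?boltzmann_gt0 // sumr_ge0 // => w _; apply/ltW/boltzmann_gt0.
have neq : const_at j (spin_flip z) != const_at j Zero.
  apply/eqP => /ffunP /(_ (Sub j (fset11 j))); rewrite !ffunE.
  by case: (z) z0.
rewrite /partition_function (bigD1 (const_at j Zero)) //=.
rewrite (bigD1 (const_at j (spin_flip z))) //=.
rewrite (boltzmann_no_clash z0 _ ez); last by case: (z) z0.
rewrite (boltzmann_no_clash z0 _ ez); last by case: (z) z0.
rewrite (_ : lambda ^ (spin_val Zero ^+ 2) = 1) //.
rewrite (_ : spin_val (spin_flip z) ^+ 2 = 1); last by case: (z) z0.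
rewrite expr1z addrA lerDl sumr_ge0 // => w _; exact/ltW/boltzmann_gt0.
Qed.

Lemma gibbs_vacant_le (j : V) (z : spin) (C : set (config V)) :
  gibbs_measure nbr beta lambda mu -> z != Zero -> measurable C ->
  (forall omega eta, (forall i, i != j -> omega i = eta i) ->
    C omega -> C eta) ->
  (forall omega n, C omega -> n \in nbr j -> omega n != z) ->
  (1 + lambda) * m (C `&` [set omega | omega j = Zero]) <= m C.
Proof.
move=> gm z0 mC indC Cz.
have mj : measurable ([set omega | omega j = Zero] : set (config V)).
  exact: sigma_on_measurable (sigma_on_coord (L := setT) _ _).
have mI := measurableI _ _ mC mj.
have l1 : 0 < 1 + lambda by rewrite addr_gt0.
rewrite mulrC -ler_pdivlMr // -lee_fin mulrC EFinM /m -!prob_realE //.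
rewrite (gm [fset j]%fset) //.
have -> : ((1 + lambda)^-1%:E * mu C =
           \int[mu]_eta ((1 + lambda)^-1 * \1_C eta)%:E)%E.
  rewrite (integralZl_indic measurableT (fun=> C)) //.
    by rewrite integral_indic // setIT.
  by rewrite ltNge invr_ge0 ltW.
apply: le_integral_nneg => eta; rewrite lee_fin.
  rewrite /gamma sumr_ge0 // => w _; rewrite mulr_ge0 //.
  rewrite divr_ge0 ?(ltW (boltzmann_gt0 _ _)) //.
  by rewrite sumr_ge0 // => ? _; exact/ltW/boltzmann_gt0.
exact: gamma_vacant_le Cz.
Qed.

End OneSite.

(** * The vacancy estimate across an edge *)

Section TreeEstimate.
Local Open Scope classical_set_scope.
Set Implicit Arguments.
Unset Strict Implicit.
Context {R : realType} {d : nat} {V : choiceType} {nbr : V -> {fset V}}.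
Hypothesis T : cayley_tree d nbr.

Lemma sigma_on_avoid (L : set V) (z : spin) (l : seq V) :
  (forall k, k \in l -> L k) ->
  sigma_on L [set omega | all (fun k => omega k != z) l].
Proof.
elim: l => [|k l IH] Ll /=.
  by rewrite (_ : mkset _ = setT) ?predeqE //; apply/sigma_algT/sigma_on_sigma.
have sL := sigma_on_sigma L.
rewrite (_ : mkset _ = ~` [set omega | omega k = z] `&`
    [set omega | all (fun k => omega k != z) l]).
  apply: (sigma_algI sL).
    by apply: (sigma_algC sL); apply: sigma_on_coord; apply: Ll; rewrite mem_head.
  by apply: IH => a al; apply: Ll; rewrite inE al orbT.
by rewrite predeqE => w /=; split=> [/andP[/eqP]|[/eqP -> ->]].
Qed.

Context {mu : probability (config V) R} {beta lambda : R}.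
Hypotheses (lambda0 : 0 < lambda) (gm : gibbs_measure nbr beta lambda mu).
Hypotheses (mc : tree_markov_chain nbr mu) (fi : flip_invariant mu).
Let m := prob_real mu.

(** The neighbours are added one at a time, each at the cost of a factor [1/2]: [A], the vacancy of
    [j] and the neighbours already treated all lie in the past of the edge from [j] to the next
    one. *)
Lemma avoids_sign (i j : V) (z : spin) (A : set (config V)) (l : seq V) :
  adj nbr i j -> z != Zero -> sigma_on (past nbr i j) A ->
  uniq l -> (forall k, k \in l -> adj nbr j k /\ k != i) ->
  2^-1 ^+ size l * m (A `&` [set omega | omega j = Zero]) <=
  m ((A `&` [set omega | omega j = Zero])
     `&` [set omega | all (fun k => omega k != z) l]).
Proof.
move=> ij z0 sA; elim: l => [|k l IH] /=.
  move=> _ _; rewrite expr0 mul1r.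
  by rewrite (_ : [set omega | true] = setT) ?setIT // predeqE.
move=> /andP[kl ul] lN; have [jk ki] := lN k (mem_head _ _).
have lN' a : a \in l -> adj nbr j a /\ a != i.
  by move=> al; apply: lN; rewrite inE al orbT.
have sP := sigma_on_sigma (past nbr j k).
have jP : past nbr j k j by exact: (past_refl T).
pose B : set (config V) := (A `&` [set omega | omega j = Zero])
     `&` [set omega | all (fun k => omega k != z) l].
have sB : sigma_on (past nbr j k) B.
  apply: (sigma_algI sP); first apply: (sigma_algI sP).
  - by apply: sigma_on_le sA => x; apply: (past_step T) => //; rewrite eq_sym.
  - exact: sigma_on_coord.
  - apply: sigma_on_avoid => a al; have [ja ai] := lN' _ al.
    have aj : adj nbr a j by rewrite (cayley_sym T).
    apply: (past_step T aj jk); last exact: (past_refl T).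
    by apply: contraNneq kl => <-.
have BZ : B `<=` [set omega | omega j = Zero] by move=> w [[]].
have := half_avoids_sign mc fi jk z0 sB BZ jP.
rewrite (_ : B `&` _ = (A `&` [set omega | omega j = Zero])
     `&` [set omega | (omega k != z) && all (fun k => omega k != z) l]).
  apply: le_trans; rewrite exprS -mulrA ler_wpM2l ?invr_ge0 //.
  exact: IH.
rewrite predeqE => w /=; split.
  by move=> [[Aw Bw] /eqP wk]; split=> //; rewrite wk Bw.
by move=> [Aw /andP[/eqP wk Bw]]; split.
Qed.

Lemma vacant_le_sign (i j : V) (z : spin) (A : set (config V)) :
  adj nbr i j -> z != Zero -> sigma_on (past nbr i j) A ->
  A `<=` [set omega | omega i != z] ->
  (1 + lambda) / 2 ^+ d * m (A `&` [set omega | omega j = Zero]) <= m A.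
Proof.
move=> ij z0 sA Az.
(* The neighbour [i] is left out because [Az] already keeps it different from [z]. *)
pose l : seq V := (nbr j `\ i)%fset.
have lP k : k \in l -> adj nbr j k /\ k != i.
  by rewrite !inE => /andP[-> jk].
have ji : i \in nbr j by move: ij; rewrite (cayley_sym T).
have sl : size l = d.
  by have := cayley_degree T j; rewrite (cardfsD1 i) ji => -[].
have := avoids_sign ij z0 sA (fset_uniq _) lP.
pose C : set (config V) := A `&` [set omega | all (fun k => omega k != z) l].
rewrite sl setIAC -/C => le1.
have mA := sigma_on_measurable sA.
have mC : measurable (C : set (config V)).
  apply: measurableI => //.
  have sN : sigma_on setT [set omega : V -> spin | all (fun k => omega k != z) l].
    exact: sigma_on_avoid.
  exact: sigma_on_measurable sN.
have : (1 + lambda) * m (C `&` [set omega | omega j = Zero]) <= m C.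
  apply: (gibbs_vacant_le lambda0 gm z0) => //.
    (* [C] ignores the spin at [j]: the past of [ij] omits [j], and [j] is not its own neighbour. *)
    move=> omega eta oe [Aw /= lw]; split.
      apply: (sigma_on_determined sA _ Aw) => k Pk; apply: oe.
      by apply/eqP => kj; rewrite kj in Pk; exact: past_notin Pk.
    apply/allP => k kl /=; rewrite -oe ?(allP lw) //.
    have [jk _] := lP _ kl.
    by apply: contraTneq jk => ->; rewrite (cayley_irr T).
  move=> omega n [Aw /= lw] nj.
  have [->|ni] := eqVneq n i; first exact: Az.
  by apply: (allP lw); rewrite !inE ni.
move=> le2; have : m C <= m A by apply: prob_real_le => // w [].
apply: le_trans; apply: le_trans le2.
rewrite -mulrA ler_wpM2l ?addr_ge0 ?ler01 ?(ltW lambda0) //.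
by rewrite -exprVn; exact: le1.
Qed.

(** Split [A] by whether [sigma_i] is [Minus]: the first part avoids [Plus], the second avoids
    [Minus]. *)
Lemma vacant_le (i j : V) (A : set (config V)) :
  adj nbr i j -> sigma_on (past nbr i j) A ->
  (1 + lambda) / 2 ^+ d * m (A `&` [set omega | omega j = Zero]) <= m A.
Proof.
move=> ij sA; have sP := sigma_on_sigma (past nbr i j).
pose M : set (config V) := [set omega | omega i = Minus].
have sM : sigma_on (past nbr i j) M.
  by apply: sigma_on_coord; exact: (past_refl T).
have s1 := sigma_algI sP sA sM.
have s2 := sigma_algI sP sA (sigma_algC sP sM).
have mA := sigma_on_measurable sA; have mM := sigma_on_measurable sM.
have mj : measurable ([set omega | omega j = Zero] : set (config V)).
  exact: sigma_on_measurable (sigma_on_coord (L := setT) _ _).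
have h1 : A `&` M `<=` [set omega | omega i != Plus] by move=> w [_ /= ->].
have h2 : A `&` ~` M `<=` [set omega | omega i != Minus].
  by move=> w [_ /eqP].
have P0 : Plus != Zero by apply/eqP.
have M0 : Minus != Zero by apply/eqP.
pose Z : set (config V) := [set omega | omega j = Zero].
have eA : m A = m (A `&` M) + m (A `&` ~` M) by exact: prob_real_split.
have eZ : m (A `&` Z) = m (A `&` M `&` Z) + m (A `&` ~` M `&` Z).
  by rewrite !(setIAC A _ Z); apply: prob_real_split => //; exact: measurableI.
rewrite -/Z eZ eA mulrDr; apply: lerD.
  exact: vacant_le_sign ij P0 s1 h1.
exact: vacant_le_sign ij M0 s2 h2.
Qed.

End TreeEstimate.

(** * Occupied trees of finite depth and compactness *)

Section Deep.
Local Open Scope classical_set_scope.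
Set Implicit Arguments.
Unset Strict Implicit.
Context {V : choiceType} (nbr : V -> {fset V}) (o : V) (s : nat).

Fixpoint occupied_to_depth (n : nat) (w : V) (omega : V -> spin) : bool :=
  occupied (omega w) &&
  if n is n'.+1 then
    (s <= count (fun c => occupied_to_depth n' c omega) (children nbr o w))%N
  else true.

(** The family [F] is left open: it will be the sigma-algebra of the branch of [w] away from [u],
    and also a constant family containing all occupation events. *)
Lemma sigma_alg_depth (F : V -> V -> set (set (V -> spin))) :
  (forall u w, w \in children nbr o u -> [/\ sigma_algebra setT (F u w),
      F u w [set omega | occupied (omega w)] &
      forall c, c \in children nbr o w -> F w c `<=` F u w]) ->
  forall n u w, w \in children nbr o u -> F u w [set omega | occupied_to_depth n w omega].
Proof.
move=> FP; elim=> [|n IH] u w wu; have [sF Fo Fc] := FP _ _ wu.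
  rewrite (_ : mkset _ = [set omega | occupied (omega w)]) //.
  by rewrite predeqE => x /=; rewrite andbT.
rewrite (_ : mkset _ = [set omega | occupied (omega w)] `&`
  [set omega | (s <= count (fun c => occupied_to_depth n c omega)
                       (children nbr o w))%N]).
  apply: (sigma_algI sF) => //.
  by apply: (sigma_alg_count sF) => c cw; apply: (Fc c) => //; apply: IH.
by rewrite predeqE => x /=; split=> [/andP[]|[-> ->]].
Qed.

Lemma occupied_to_depth_le n n' w omega : (n <= n')%N ->
  occupied_to_depth n' w omega -> occupied_to_depth n w omega.
Proof.
elim: n n' w => [|n IH] [|n'] w //= nn' /andP[-> //].
by move=> /= /leq_trans -> //; apply: sub_count => c; apply: IH.
Qed.

Lemma card_fset_count (X : {fset V}) (P : {pred V}) :
  #|` [fset c in X | c \in P]%fset| = count P X.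
Proof.
rewrite -size_filter; apply: perm_size; apply: uniq_perm.
- exact: fset_uniq.
- by apply: filter_uniq; exact: fset_uniq.
- by move=> c; rewrite mem_filter !inE andbC.
Qed.

(** For the converse, the infinite tree consists of the descendants that succeed at every depth. It
    has enough branching because each vertex has finitely many children. *)
Lemma occupied_subtree_depth (v : V) (omega : V -> spin) :
  has_occupied_subtree nbr o v s omega <->
  forall n, occupied_to_depth n v omega.
Proof.
split=> [[X [_ Xv Xo Xs]] n|all_depth].
  elim: n v Xv => [|n IH] w Xw /=; rewrite Xo //=.
  apply: leq_trans (Xs _ Xw) _; rewrite card_fset_count.
  by apply: sub_count => c; rewrite inE => /IH.
exists [set w | descendants nbr o v w /\ forall n, occupied_to_depth n w omega].
split=> [w []//|//|w [_ /(_ 0%N)]|w [[p vp pw] dw]].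
- by split=> //; exists [::].
- by rewrite /= andbT.
(* Every child that fails at some depth fails at depth [N] already. *)
have bound (l : seq V) : exists N, forall c, c \in l ->
    occupied_to_depth N c omega -> forall n, occupied_to_depth n c omega.
  elim: l => [|c l [N IH]]; first by exists 0%N.
  have [dc|/existsNP[n /negP dc]] := pselect (forall n, occupied_to_depth n c omega).
    by exists N => a; rewrite inE => /orP[/eqP->|/IH].
  exists (maxn N n) => a; rewrite inE => /orP[/eqP->|al].
    by move/(occupied_to_depth_le (leq_maxr _ _)); rewrite (negbTE dc).
  by move/(occupied_to_depth_le (leq_maxl _ _)); apply: IH.
have [N NP] := bound (children nbr o w).
(* Depth [N.+1] at [w] examines the children to depth [N]. *)
have /= /andP[_ /leq_trans] := dw N.+1; apply; rewrite card_fset_count.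
rewrite -!size_filter; apply/uniq_leq_size; first by apply: filter_uniq; exact: fset_uniq.
move=> c; rewrite !mem_filter => /andP[dc cw]; rewrite cw andbT inE.
split; last exact: NP.
exists (rcons p c); last by rewrite last_rcons.
by rewrite rcons_path vp pw.
Qed.

End Deep.

(** * Failure probabilities by induction on the depth *)

Section Percolation.
Local Open Scope classical_set_scope.
Set Implicit Arguments.
Unset Strict Implicit.
Context {R : realType} {d : nat} {V : choiceType} {nbr : V -> {fset V}}.
Hypothesis T : cayley_tree d nbr.
Context {mu : probability (config V) R} {o : V} {s : nat} {delta : R}.
Hypotheses (sd : (s < d)%N).
Let m := prob_real mu.

Lemma sigma_on_depth n (u w : V) : w \in children nbr o u ->
  sigma_on (past nbr w u) [set omega | occupied_to_depth nbr o s n w omega].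
Proof.
apply: (@sigma_alg_depth V nbr o s (fun u w => sigma_on (past nbr w u))).
move=> {}u {}w wu; have uw : adj nbr w u.
  by move: wu; rewrite in_children (cayley_sym T) => /andP[].
split; first exact: sigma_on_sigma.
  by apply: sigma_on_occupied; exact: (past_refl T).
move=> c; rewrite (children_eq T wu) !inE => /andP[cu cw].
by apply: sigma_on_le => x; apply: (past_step T) => //; rewrite (cayley_sym T).
Qed.

Lemma two_of_count (I : eqType) (P : pred I) (l : seq I) : uniq l ->
  (1 < count P l)%N -> exists a b, [/\ a \in l, b \in l, a != b, P a & P b].
Proof.
move=> ul; rewrite -size_filter; have uf : uniq [seq x <- l | P x].
  exact: filter_uniq.
have : forall a, a \in [seq x <- l | P x] -> P a && (a \in l).
  by move=> a; rewrite mem_filter.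
move: uf; case: [seq x <- l | P x] => [|a [|b q]] //= /andP[]; rewrite inE negb_or.
move=> /andP[ab _] _ H _; exists a, b.
have /andP[] := H a (mem_head _ _).
have /andP[] : P b && (b \in l) by apply: H; rewrite !inE eqxx orbT.
by [].
Qed.

(* If a vertex has at most [d - 2] successful children then two of its [d]
   children fail, which given the past has probability at most
   [(d * delta) ^+ 2]. *)
Lemma depth_fails_le n (u w : V) (A : set (config V)) :
  0 <= delta ->
  (forall i j (A : set (config V)), adj nbr i j -> sigma_on (past nbr i j) A ->
    m (A `&` [set omega | omega j = Zero])
      <= (delta - (d%:R * delta) ^+ 2) * m A) ->
  w \in children nbr o u -> sigma_on (past nbr u w) A ->
  m (A `&` ~` [set omega | occupied_to_depth nbr o s n w omega]) <= delta * m A.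
Proof.
(* [A] varies in the induction, since the failure of a sibling is added to it. *)
move=> delta0 vac; elim: n u w A => [|n IH] u w A wu sA;
  have uw : adj nbr u w by (move: wu; rewrite in_children => /andP[]).
  have mA0 : 0 <= m A by exact: prob_real_ge0.
  rewrite (_ : ~` _ = [set omega | omega w = Zero]).
    apply: le_trans (vac _ _ _ uw sA) _; rewrite ler_wpM2r //.
    by rewrite gerBl sqr_ge0.
  rewrite predeqE => x /=; rewrite andbT occupiedE.
  by split=> [/negP/negPn/eqP//|->].
have wu' : adj nbr w u by rewrite (cayley_sym T).
have mA := sigma_on_measurable sA.
have mD k c : c \in children nbr o w ->
    measurable ([set omega | occupied_to_depth nbr o s k c omega] : set (config V)).
  by move=> cw; apply: sigma_on_measurable (sigma_on_depth _ cw).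
have mDw k : measurable ([set omega | occupied_to_depth nbr o s k w omega] : set (config V)).
  by apply: sigma_on_measurable (sigma_on_depth _ wu).
pose X : set (config V) := A `&` ~` [set omega |
  (s <= count (fun c => occupied_to_depth nbr o s n c omega)
         (children nbr o w))%N].
have mX : measurable X.
  apply: measurableI => //; apply: measurableC.
  apply: (sigma_alg_count (sigma_on_sigma setT)) => c cw; exact: mD.
have mj : measurable ([set omega | omega w = Zero] : set (config V)).
  exact: sigma_on_measurable (sigma_on_coord (L := setT) _ _).
pose l : seq V := children nbr o w.
(* Ordered pairs of distinct children, at most [d * d] of them; hence the factor [d^2] in
   [(d * delta)^2]. *)
pose pairs := [seq p <- [seq (a, b) | a <- l, b <- l] | p.1 != p.2].
have pairsP p : p \in pairs -> [/\ p.1 \in l, p.2 \in l & p.1 != p.2].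
  by rewrite mem_filter => /andP[ab /allpairsP[q [q1 q2 E]]]; rewrite {}E in ab *.
pose S (p : V * V) : set (config V) :=
  A `&` ~` [set omega | occupied_to_depth nbr o s n p.1 omega]
    `&` ~` [set omega | occupied_to_depth nbr o s n p.2 omega].
have mXle : m X <= (size pairs)%:R * (delta * (delta * m A)).
  apply: (prob_real_union_bound (S := S)) => // [p /pairsP[l1 l2 _]|p /pairsP[l1 l2 p12]|x [Ax /= /negP]].
  - apply: measurableI; last exact: measurableC (mD n _ l2).
    by apply: measurableI => //; exact: measurableC (mD n _ l1).
  - have child c : c \in l -> adj nbr w c /\ c != u.
      by rewrite /l (children_eq T wu) !inE => /andP[].
    have [a1 u1] := child _ l1; have [a2 u2] := child _ l2.
    have sA' c : adj nbr w c -> c != u -> sigma_on (past nbr w c) A.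
      move=> wc cu; apply: sigma_on_le sA => x.
      by apply: (past_step T) => //; rewrite eq_sym.
    (* The failure of the first child belongs to the past of the second, so the induction hypothesis
       applies twice and yields [delta^2]. *)
    have s2 : sigma_on (past nbr w p.2)
        (A `&` ~` [set omega | occupied_to_depth nbr o s n p.1 omega]).
      have sP := sigma_on_sigma (past nbr w p.2).
      apply: (sigma_algI sP); first exact: sA'.
      apply: (sigma_algC sP); apply: sigma_on_le (sigma_on_depth n l1) => x.
      by apply: (past_step T) => //; rewrite (cayley_sym T).
    apply: le_trans (IH _ _ _ l2 s2) _; rewrite ler_wpM2l //.
    exact: IH l1 (sA' _ a1 u1).
  - rewrite -ltnNge => lt.
    (* Fewer than [s] successes, with [s < d], leave at least two failures among [d] children. *)
    have lt1 : (1 < count (predC (fun c => occupied_to_depth nbr o s n c x)) l)%N.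
      move: lt (count_predC (fun c => occupied_to_depth nbr o s n c x) l).
      by rewrite -/l (_ : size l = d); [lia|exact: (size_children T wu)].
    have [a [b [al bl ab Pa Pb]]] := two_of_count (fset_uniq _) lt1.
    exists (a, b); first by rewrite mem_filter ab; apply/allpairsP; exists (a, b).
    by split; [split=> //|]; exact/negP.
have sz : (size pairs <= d * d)%N.
  rewrite size_filter; apply: leq_trans (count_size _ _) _.
  by rewrite size_allpairs (_ : size l = d) // (size_children T wu).
have mA0 : 0 <= m A by exact: prob_real_ge0.
have mX2 : m X <= (d%:R * delta) ^+ 2 * m A.
  apply: le_trans mXle _.
  rewrite (_ : (d%:R * delta) ^+ 2 * m A = (d * d)%:R * (delta * (delta * m A))).
    by rewrite ler_wpM2r ?ler_nat // !mulr_ge0.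
  by rewrite natrM; ring.
have : m (A `&` ~` [set omega | occupied_to_depth nbr o s n.+1 w omega]) <=
   m (A `&` [set omega | omega w = Zero]) + m X.
  apply: prob_real_leU => //; [exact/measurableI/measurableC|exact: measurableI|].
  move=> x [Ax /= /negP]; rewrite negb_and occupiedE negbK => /orP[/eqP|/negP].
    by left.
  by right.
move/le_trans; apply; apply: le_trans (lerD (vac _ _ _ uw sA) mX2) _.
by rewrite -mulrDl subrK.
Qed.

End Percolation.

(** * Invariance of occupation events under the time evolution *)

Section TimeEvolution.
Local Open Scope classical_set_scope.
Set Implicit Arguments.
Unset Strict Implicit.
Context {R : realType} {V : choiceType}.

Section Deterministic.
Context (K : R.-pker (config V) ~> (config V)).

Definition kernel_fixes : set (set (config V)) :=
  [set A | measurable A /\ forall omega, K omega A = (\1_A omega)%:E].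

(** Complements use total mass one. For a union, either some member has mass one at [omega], or all
    are null and countable subadditivity applies. *)
Lemma sigma_alg_kernel_fixes : sigma_algebra setT kernel_fixes.
Proof.
split=> [|A [mA KA]|A FA].
- by split=> // omega; rewrite measure0 indic0.
- rewrite setTD; split=> [|omega]; first exact: measurableC.
  have : (K omega A + K omega (~` A) = 1)%E.
    rewrite -measureU ?setICr ?setUv //; last exact: measurableC.
    exact: prob_kernel.
  rewrite KA indicC !indicE.
  by case: (omega \in A) => /=; rewrite ?add0e //
    => /(congr1 (fun x => x - 1%:E))%E; rewrite addeAC subee // add0e.
- have mA n : measurable (A n) by case: (FA n).
  have mU : measurable (\bigcup_n A n) by exact: bigcupT_measurable.
  split=> // omega.
  have [[n _ An]|nA] := pselect ((\bigcup_n A n) omega).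
    rewrite indicE mem_set; last by exists n.
    apply/le_anti/andP; split.
      by rewrite -(prob_kernel (s := K) omega); apply: le_measure; rewrite ?inE.
    have [_ /(_ omega)] := FA n; rewrite indicE mem_set // => <-.
    by apply: le_measure; rewrite ?inE // => x Ax; exists n.
  rewrite indicE memNset //; apply/le_anti; rewrite measure_ge0 andbT.
  apply: le_trans (generalized_Boole_inequality _ mA mU) _.
  rewrite eseries0 // => n _ _; have [_ ->] := FA n.
  by rewrite indicE memNset // => An; apply: nA; exists n.
Qed.

(** The cylinder formula at the single site [i] gives vacancy the mass
    [flip_kernel t (omega i) Zero], which is 1 or 0 according to whether [omega i] is [Zero]. *)
Lemma kernel_fixes_occupied (t : R) (i : V) : product_flip_kernel t K ->
  kernel_fixes [set omega | occupied (omega i)].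
Proof.
move=> KP; rewrite (_ : mkset _ = ~` [set omega | omega i = Zero]); last first.
  by rewrite predeqE => w /=; rewrite occupiedE; split=> [/eqP|/eqP].
apply: (sigma_algC sigma_alg_kernel_fixes); split.
  exact: sigma_on_measurable (sigma_on_coord (L := setT) _ _).
move=> omega; have := KP omega (fun=> Zero) [fset i]%fset.
rewrite big_seq_fset1 (_ : mkset _ = [set zeta | zeta i = Zero]); last first.
  rewrite predeqE => w /=; split=> [|wi k]; first by apply; rewrite inE.
  by rewrite inE => /eqP ->.
move=> ->; congr EFin; rewrite /flip_kernel indicE /= andbF !mulr0 add0r andbT.
have -> : clash (omega i) Zero = false by case: (omega i).
rewrite mulr0 add0r; congr (nat_of_bool _)%:R.
by apply/eqP/idP; rewrite inE.
Qed.

End Deterministic.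

(** The first premise is membership in the sigma-algebra generated by the occupation events, in the
    form used to instantiate it with [kernel_fixes]. *)
Lemma time_evolved_occupation (t : R) (mu mut : probability (config V) R)
    (A : set (config V)) :
  (forall F : set (set (config V)), sigma_algebra setT F ->
    (forall i, F [set omega | occupied (omega i)]) -> F A) ->
  time_evolved t mu mut -> mut A = mu A.
Proof.
move=> FA [K KP mutE].
have [mA KA] := FA _ (sigma_alg_kernel_fixes K)
  (fun i => kernel_fixes_occupied i KP).
rewrite mutE //; under eq_integral do rewrite KA.
by rewrite integral_indic // setIT.
Qed.

End TimeEvolution.

(** * The critical activity and the passage to infinite depth *)

Theorem proposition2p10 (R : realType) (d : nat) (hd : (2 <= d)%N) :
  exists2 lambda_b : R, 0 < lambda_b &
  forall lambda : R, lambda_b <= lambda ->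
  exists2 c : R, 0 < c &
  forall (beta : R) (s : nat), 0 < beta -> (s <= d - 1)%N ->
  forall (V : choiceType) (nbr : V -> {fset V}), cayley_tree d nbr ->
  forall mu : probability (config V) R,
    intermediate_measure nbr beta lambda mu ->
  forall (t : R) (mut : probability (config V) R), 0 <= t ->
    time_evolved t mu mut ->
  forall o v : V, v <> o ->
    c <= subtree_prob nbr mut o v s.
Proof.
have d2 : 2 <= d%:R :> R by rewrite ler_nat.
have p2 : 0 < 2 ^+ d :> R by rewrite exprn_gt0.
have d1 : 1 <= d%:R ^+ 2 :> R by apply: exprn_ege1; lra.
have lb0 : 0 < 4 * d%:R ^+ 2 * 2 ^+ d :> R by rewrite !mulr_gt0 ?exprn_gt0 //; lra.
(* Chosen so that [2^d / (1 + lambda)] is at most [1 / (4 d^2)], the vacancy bound required by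
   [deltaE] below. *)
exists (4 * d%:R ^+ 2 * 2 ^+ d) => // lambda le_lambda.
exists 2^-1 => [|beta s beta0 sd V nbr T mu im t mut t0 evo o v /(parent_exists T)[u vu]].
  by rewrite invr_gt0.
have lambda0 : 0 < lambda by exact: lt_le_trans le_lambda.
have {}sd : (s < d)%N by lia.
(* The maximiser of [x - (d x)^2]. *)
pose delta : R := (2 * d%:R ^+ 2)^-1.
have delta0 : 0 <= delta by rewrite invr_ge0 mulr_ge0 // exprn_ge0.
have delta_half : delta <= 2^-1.
  have dpos : 0 < 2 * d%:R ^+ 2 :> R by lra.
  by rewrite /delta lef_pV2 ?posrE //; lra.
have deltaE : delta - (d%:R * delta) ^+ 2 = (4 * d%:R ^+ 2)^-1.
  by rewrite /delta; field; rewrite gt_eqF //; lra.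
have vac i j (A : set (config V)) : adj nbr i j ->
    sigma_on (past nbr i j) A ->
    prob_real mu (A `&` [set omega | omega j = Zero])%classic
      <= (delta - (d%:R * delta) ^+ 2) * prob_real mu A.
  move=> ij sA; have [gm mc _ fi] := im.
  have le := vacant_le T lambda0 gm mc fi ij sA.
  rewrite deltaE mulrC ler_pdivlMr; last by rewrite mulr_gt0 ?exprn_gt0 //; lra.
  apply: le_trans le; rewrite mulrC ler_wpM2r ?prob_real_ge0 //.
  by rewrite ler_pdivlMr //; lra.
pose D n : set (config V) := [set omega | occupied_to_depth nbr o s n v omega]%classic.
have sT : sigma_on (past nbr u v) [set: V -> spin]%classic.
  exact/sigma_algT/sigma_on_sigma.
have mD n : measurable (D n) by exact: sigma_on_measurable (sigma_on_depth T _ vu).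
have D_ge n : 2^-1 <= prob_real mu (D n).
  have := prob_real_split mu measurableT (mD n).
  have : prob_real mu (setT `&` ~` D n)%classic <= delta * prob_real mu setT.
    have le := depth_fails_le T sd n delta0 vac vu sT.
    exact le.
  rewrite prob_realT !setTI mulr1; lra.
have mutD n : mut (D n) = mu (D n).
  apply: time_evolved_occupation evo => F sF Focc.
  apply: (@sigma_alg_depth V nbr o s (fun _ _ => F) _ n u v vu) => _ w _.
  by split=> [||c _ A].
pose occ : set (config V) := [set omega | occupied (omega v)]%classic.
have eqE : ([set omega | has_occupied_subtree nbr o v s omega]
    `&` [set omega | occupied (omega v)] = \bigcap_n D n)%classic.
  rewrite predeqE => omega; split=> [[/occupied_subtree_depth Do _] n _|Do].
    exact: Do.
  by split; [apply/occupied_subtree_depth => n; exact: Do|case/andP: (Do 0%N I)].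
have mcap : measurable (\bigcap_n D n)%classic by exact: bigcapT_measurable.
have mocc : measurable occ.
  exact: sigma_on_measurable (sigma_on_occupied (L := setT) _).
have cap_ge : 2^-1 <= prob_real mut (\bigcap_n D n)%classic.
  rewrite -lee_fin -prob_realE //.
  (* Continuity from above along the decreasing events [D n]. *)
  apply: cvge_ge (nonincreasing_cvg_mu (mu := mut) _ mD mcap _).
  - near=> n; rewrite /= mutD; rewrite prob_realE // lee_fin; exact: D_ge.
  - exact: le_lt_trans (probability_le1 _ (mD 0%N)) (ltry _).
  - move=> n k nk; apply/subsetPset => omega; exact: occupied_to_depth_le.
have cap_le : prob_real mut (\bigcap_n D n)%classic <= prob_real mut occ.
  by apply: prob_real_le => // omega /(_ 0%N I) /andP[].
have occ_le : prob_real mut occ <= 1.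
  by rewrite -(prob_realT mut); apply: prob_real_le.
(* The denominator lies between [1/2] and 1, so the quotient is genuine and division does not
   decrease the numerator. *)
rewrite /subtree_prob eqE ler_pdivlMr.
  by apply: le_trans cap_ge; rewrite ler_piMr.
by apply: lt_le_trans cap_le; apply: lt_le_trans cap_ge; rewrite invr_gt0.
Unshelve. all: by end_near.
Qed.
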